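(* Assume the state process $\{\omega[t]\}_{t\ge1}$ satisfies the Non i.i.d. System State model (defined in the context), with $\mathbb{E}[e[t]]=\bar e$ for all $t$. Let $\mathbf{q}\in\mathcal{P}$ be any fixed vector satisfying $\sum_{i=1}^n q_i\le\bar e$. Let $V>0$, let $\mathbf{p}[t]$ be produced by Algorithm 1 (defined in the context) with parameter $V$, and let $B=(\max\{e^{\max},p^{\max}\})^2$. Then for all $t\in\{1,2,\ldots\}$, $$\frac1t\sum_{\tau=1}^t\mathbb{E}[U(\mathbf{p}[\tau];\omega[\tau])]\ \ge\ \frac1t\sum_{\tau=1}^t\mathbb{E}[U(\mathbf{q};\omega[\tau])]-\frac{V(p^{\max})^2}{2t}-\frac{B}{2Vt}-\frac{D^2+B}{2V}.$$ In particular, if $V=1/\epsilon$ with $\epsilon>0$, then $$\frac1t\sum_{\tau=1}^t\mathbb{E}[U(\mathbf{p}[\tau];\omega[\tau])]\ \ge\ \frac1t\sum_{\tau=1}^t\mathbb{E}[U(\mathbf{q};\omega[\tau])]-O(\epsilon),\qquad\forall t\ge\frac1{\epsilon^2},$$ where the constant in $O(\epsilon)$ depends only on $p^{\max},e^{\max},D$ (and $t$ ranges over positive integers).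
   Context: Setting. $n\ge 1$ is an integer and $p^{\max}>0$, $e^{\max}>0$ are constants; $\mathcal{P}=\{\mathbf{p}\in\mathbb{R}^n:\sum_{i=1}^n p_i\le p^{\max},\ p_i\ge 0\ \forall i\}$. States are $\omega=(e,\mathbf{s})\in\Omega$, where $e$ (harvested energy) is a real number and $\mathbf{s}$ is a device state. For each $\omega\in\Omega$, the utility $U(\cdot;\omega):\mathcal{P}\to\mathbb{R}$ is continuous and concave. For each $\mathbf{p}\in\mathcal{P}$, $\omega\in\Omega$, $\nabla_{\mathbf{p}}U(\mathbf{p};\omega)$ denotes a chosen subgradient of this concave function (the gradient if differentiable), i.e. $U(\mathbf{q};\omega)\le U(\mathbf{p};\omega)+(\nabla_{\mathbf{p}}U(\mathbf{p};\omega))^{\mathsf T}(\mathbf{q}-\mathbf{p})$ for all $\mathbf{q}\in\mathcal{P}$. There are constants $D_1,\ldots,D_n>0$ such that the $i$-th component of $\nabla_{\mathbf{p}}U(\mathbf{p};\omega)$ has absolute value at most $D_i$ for all $\mathbf{p}\in\mathcal{P},\omega\in\Omega$, and $D>0$ is a constant with $\|\nabla_{\mathbf{p}}U(\mathbf{p};\omega)\|\le D$ for all $\mathbf{p},\omega$ (e.g. $D=\sqrt{\sum_i D_i^2}$), $\|\cdot\|$ being the Euclidean norm. $U$ and the subgradient selection are jointly measurable and $\mathbb{E}[U(\mathbf{p};\omega[t])]$ is finite for all $\mathbf{p}\in\mathcal{P}$ and all $t$. Non i.i.d. System State model. $\omega[t]=(e[t],\mathbf{s}[t])\in\Omega$,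 $t\in\{1,2,\ldots\}$, is a stochastic process such that: (1) $\{\mathbf{s}[t]\}_{t\ge1}$ is an arbitrary process, possibly time-correlated and with different distributions at each $t$; (2) $\{e[t]\}_{t\ge1}$ are independent random variables with values in $[0,e^{\max}]$ and the same expectation $\mathbb{E}[e[t]]=\bar e$ for every $t$, and for each $t\in\{1,2,\ldots\}$, $e[t+1]$ is independent of $\{(e[\tau],\mathbf{s}[\tau])\}_{\tau=1}^t$. Algorithm 1 (parameter $V>0$). Initialize $Q[0]=0$ and $\mathbf{p}[1]=\mathbf{0}$. At the end of each slot $t\in\{1,2,\ldots\}$, observe $\omega[t]$ and set $$Q[t]=\min\Big\{Q[t-1]+e[t]-\sum_{i=1}^n p_i[t],\,0\Big\},$$ $$\mathbf{p}[t+1]=\mathrm{Proj}_{\mathcal{P}}\Big\{\mathbf{p}[t]+\tfrac1V\nabla_{\mathbf{p}}U(\mathbf{p}[t];\omega[t])+\tfrac1{V^2}Q[t]\mathbf{1}\Big\},$$ where $\mathrm{Proj}_{\mathcal{P}}$ is Euclidean projection onto $\mathcal{P}$ and $\mathbf{1}$ is the all-ones vector. *)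

(* Defs.v *)
From HB Require Import structures.
From mathcomp Require Import all_boot all_order all_algebra.
From mathcomp Require Import all_classical all_reals all_analysis.

Set Implicit Arguments.
Unset Strict Implicit.
Unset Printing Implicit Defensive.

Import Order.TTheory GRing.Theory Num.Theory.
Import numFieldNormedType.Exports.

Local Open Scope classical_set_scope.
Local Open Scope ring_scope.

Section Euclidean.
Context {R : realType} {n : nat}.
Implicit Types u v x : 'rV[R]_n.

Definition dotv u v : R := \sum_(i < n) u ord0 i * v ord0 i.

(* The library norm on ['rV[R]_n] is the sup norm. *)
Definition norm2 v : R := Num.sqrt (dotv v v).

Definition power_region (pmax : R) : set 'rV[R]_n :=
  [set p | \sum_(i < n) p ord0 i <= pmax /\ forall i, 0 <= p ord0 i].

(* The default value 0 of [xget] is never used when [A] is nonempty, closed and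
   convex: the set of nearest points is then a singleton. *)
Definition Proj (A : set 'rV[R]_n) x : 'rV[R]_n :=
  xget 0 [set y | A y /\ forall z, A z -> norm2 (x - y) <= norm2 (x - z)].

End Euclidean.

(* Measurability of the restriction of [f] to [D] for the trace sigma-algebra.
   It agrees with [measurable_fun D f] when [D] is measurable; otherwise the
   latter holds vacuously. *)
Definition measurable_restr d1 d2 (T1 : measurableType d1)
    (T2 : measurableType d2) (D : set T1) (f : T1 -> T2) : Prop :=
  preimage_set_system D f measurable `<=` strace measurable D.

Section Utility.
Context {R : realType} {dS : measure_display} {S : measurableType dS}.
Variables (n : nat) (pmax : R) (Omega : set (R * S)).

(* Joint measurability on the power region times [Omega]; R^n carries the
   product Borel sigma-algebra, which the library provides on [n.-tuple R]. *)
Definition jointly_measurable (f : 'rV[R]_n -> R * S -> R) : Prop :=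
  let row (x : n.-tuple R) : 'rV[R]_n := \row_i tnth x i in
  measurable_restr
    [set z : n.-tuple R * (R * S) | power_region pmax (row z.1) /\ Omega z.2]
    (fun z => f (row z.1) z.2).

(* [gradU p w] is the selected subgradient of [U ^~ w] at [p], and [Di i] bounds
   its [i]-th component. *)
Record utility_model (D : R) (Di : 'I_n -> R)
    (U : 'rV[R]_n -> R * S -> R) (gradU : 'rV[R]_n -> R * S -> 'rV[R]_n) :
    Prop := UtilityModel {
  utility_continuous : forall w, Omega w ->
    {within power_region pmax, continuous (U ^~ w)} ;
  utility_concave : forall w, Omega w ->
    convex_function (power_region pmax : set (convex_lmodType 'rV[R]_n))
      (fun p => - U p w) ;
  utility_subgradient : forall w p q, Omega w ->
    power_region pmax p -> power_region pmax q ->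
    U q w <= U p w + dotv (gradU p w) (q - p) ;
  utility_component_pos : forall i, 0 < Di i ;
  utility_component_bound : forall w p i, Omega w -> power_region pmax p ->
    `|gradU p w ord0 i| <= Di i ;
  utility_gradient_bound : forall w p, Omega w -> power_region pmax p ->
    norm2 (gradU p w) <= D ;
  utility_measurable : jointly_measurable U ;
  utility_gradient_measurable :
    forall i, jointly_measurable (fun p w => gradU p w ord0 i)
}.

End Utility.

Section Independence.
Context {R : realType} {d : measure_display} {T : measurableType d}.
Variable P : probability T R.

Definition mutually_independent (I : set nat) (X : nat -> T -> R) : Prop :=
  forall (s : seq nat) (A : nat -> set R), uniq s ->
    (forall i, i \in s -> I i) -> (forall i, i \in s -> measurable (A i)) ->
    P (\bigcap_(i in [set` s]) (X i @^-1` A i)) =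
    (\prod_(i <- s) P (X i @^-1` A i))%E.

Definition independent_of (X : T -> R) (G : set (set T)) : Prop :=
  forall (A : set R) (B : set T), measurable A -> G B ->
    P (X @^-1` A `&` B) = (P (X @^-1` A) * P B)%E.

End Independence.

Section Process.
Context {R : realType} {dS d : measure_display}.
Context {S : measurableType dS} {T : measurableType d}.
Variable P : probability T R.

(* Time starts at 1: [omega 0] is never constrained nor used. *)
Implicit Type omega : nat -> T -> R * S.

Definition energy omega (t : nat) : T -> R := fun x => (omega t x).1.

Definition history omega (t : nat) : set (set T) :=
  <<s \bigcup_(tau in [set k : nat | (1 <= k <= t)%N])
        g_sigma_algebra_preimage (omega tau) >>.

Record noniid_state_model (Omega : set (R * S)) (emax ebar : R) omega : Prop :=
    NonIIDStateModel {
  state_measurable : forall t, (1 <= t)%N -> measurable_fun setT (omega t) ;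
  state_in : forall t x, (1 <= t)%N -> Omega (omega t x) ;
  energy_range : forall t x, (1 <= t)%N -> 0 <= energy omega t x <= emax ;
  energy_mean : forall t, (1 <= t)%N -> ('E_P[energy omega t] = ebar%:E)%E ;
  energy_independent :
    mutually_independent P [set t : nat | (1 <= t)%N] (energy omega) ;
  energy_indep_history : forall t, (1 <= t)%N ->
    independent_of P (energy omega t.+1) (history omega t)
}.

Record algorithm1 (n : nat) (pmax V : R)
    (gradU : 'rV[R]_n -> R * S -> 'rV[R]_n) omega
    (Q : nat -> T -> R) (p : nat -> T -> 'rV[R]_n) : Prop := Algorithm1 {
  queue_init : forall x, Q 0%N x = 0 ;
  power_init : forall x, p 1%N x = 0 ;
  queue_step : forall t x, (1 <= t)%N ->
    Q t x =
    Num.min (Q t.-1 x + energy omega t x - \sum_(i < n) p t x ord0 i) 0 ;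
  power_step : forall t x, (1 <= t)%N ->
    p t.+1 x = Proj (power_region pmax)
      (p t x + V^-1 *: gradU (p t x) (omega t x)
       + (V ^- 2 * Q t x) *: const_mx 1)
}.

Definition avg_utility (n : nat) (U : 'rV[R]_n -> R * S -> R) omega
    (p : nat -> T -> 'rV[R]_n) (t : nat) : \bar R :=
  ((t%:R^-1)%:E *
    \sum_(1 <= tau < t.+1) 'E_P[fun x => U (p tau x) (omega tau x)])%E.

End Process.

(* Main.v *)
Require Import Defs.
From HB Require Import structures.
From mathcomp Require Import all_boot all_order all_algebra.
From mathcomp Require Import ring lra.
From mathcomp Require Import all_classical all_reals all_analysis.
From mathcomp Require Import measurable_realfun.

Set Implicit Arguments.
Unset Strict Implicit.
Unset Printing Implicit Defensive.

Import Order.TTheory GRing.Theory Num.Theory.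
Import numFieldNormedType.Exports.

Local Open Scope classical_set_scope.
Local Open Scope ring_scope.

(* Fix a sample point and write Delta f = f[t+1] - f[t]. The variational
   inequality of the projection defining p[t+1], the subgradient inequality at
   p[t] and the drift of Q^2 from t to t+1 give, pointwise,
     V (U(q; w[t]) - U(p[t]; w[t])) <= (D^2 + B)/2 + Q[t] (e[t+1] - sum_i q_i)
       - V^2/2 Delta |q - p|^2 - 1/2 Delta Q^2.
   Summing telescopes the last two terms. Since Q[t] <= 0 is determined by the
   history up to t, it is independent of e[t+1], so that
   E[Q[t] (e[t+1] - sum_i q_i)] = E[Q[t]] (ebar - sum_i q_i) <= 0.
   Measurability of p[t] comes from the explicit form of the projection onto
   the power region: Proj(x)_i = max(x_i - lam, 0), where the water level
   lam >= 0 satisfies lam <= c iff sum_i max(x_i - c, 0) <= pmax, for c >= 0. *)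

(** * Euclidean projection onto the power region by water filling *)

Section Projection.
Context {R : realType} {n : nat}.
Implicit Types u v x y z : 'rV[R]_n.

Lemma dotv_ge0 v : 0 <= dotv v v.
Proof. by apply: sumr_ge0 => i _; rewrite -expr2 sqr_ge0. Qed.

Lemma norm2_sqr v : norm2 v ^+ 2 = dotv v v.
Proof. by rewrite sqr_sqrtr ?dotv_ge0. Qed.

Lemma dotv_eq0 v : dotv v v = 0 -> v = 0.
Proof.
move=> /eqP; rewrite psumr_eq0 => [/allP v0|i _]; last by rewrite -expr2 sqr_ge0.
apply/rowP => i; have := v0 i (mem_index_enum _).
by rewrite mulf_eq0 orbb mxE => /eqP.
Qed.

(** The obtuse-angle condition gives |x - y|^2 + |z - y|^2 <= |x - z|^2. Hence [y] is a nearest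
    point, and any nearest point [z] picked by [xget] satisfies |z - y|^2 <= 0. *)
Lemma Proj_variational (A : set 'rV[R]_n) x y :
  A y -> (forall z, A z -> dotv (x - y) (z - y) <= 0) -> Proj A x = y.
Proof.
move=> Ay xy.
have pythagoras z : A z -> dotv (x - y) (x - y) + dotv (z - y) (z - y) <=
                           dotv (x - z) (x - z).
  move=> /xy; rewrite -(@ler_pM2l _ 2) // mulr0 -(lerD2l (dotv (x - z) (x - z))).
  rewrite addr0; apply: le_trans; rewrite le_eqVlt; apply/orP; left; apply/eqP.
  rewrite /dotv mulr_sumr -!big_split/=; apply: eq_bigr => i _.
  by rewrite !mxE; ring.
rewrite /Proj; case: xgetP => [z _ [Az]|/(_ y)[]]; last first.
  split=> // z Az; rewrite /norm2 ler_wsqrtr//; apply: le_trans (pythagoras _ Az).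
  by rewrite lerDl dotv_ge0.
move=> /(_ _ Ay) zy; apply/eqP; rewrite -subr_eq0; apply/eqP/dotv_eq0/le_anti.
rewrite dotv_ge0 andbT.
have : norm2 (x - z) ^+ 2 <= norm2 (x - y) ^+ 2.
  by rewrite ler_sqr ?nnegrE ?sqrtr_ge0.
by rewrite !norm2_sqr => /(le_trans (pythagoras _ Az)); rewrite gerDl.
Qed.

(** Total power allocated by water filling at level [c]. *)
Definition clip_sum x (c : R) : R := \sum_(i < n) Num.max (x ord0 i - c) 0.

Lemma clip_sum_continuous x : continuous (clip_sum x).
Proof.
move=> c; rewrite /continuous_at /clip_sum.
apply: (@cvg_big R _ +%R 0 xpredT) => [|i _]; first exact: add_continuous.
apply: (@continuous_max _ _ (fun c => x ord0 i - c) (cst 0)).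
  by apply: cvgB; [exact: cvg_cst | exact: cvg_id].
exact: cvg_cst.
Qed.

(** A coordinate above [c2] contributes strictly more at [c1], and no coordinate contributes
    less. *)
Lemma clip_sum_lt x c1 c2 : c1 < c2 -> 0 < clip_sum x c2 ->
  clip_sum x c2 < clip_sum x c1.
Proof.
move=> c12 pos.
have [i xi] : exists i, 0 < Num.max (x ord0 i - c2) 0.
  apply: contrapT => /forallNP noi; move: pos; rewrite ltNge; apply/negP/negPn.
  by apply: sumr_le0 => i _; rewrite leNgt; apply/negP/noi.
have mono j : Num.max (x ord0 j - c2) 0 <= Num.max (x ord0 j - c1) 0.
  by rewrite ge_max !le_max lerD2l lerN2 (ltW c12) lexx orbT.
rewrite /clip_sum (bigD1 i)//= [ltRHS](bigD1 i)//=.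
apply: ltr_leD; last by apply: ler_sum => j _.
move: xi; rewrite lt_max ltxx orbF => xi.
by rewrite (max_idPl (ltW xi)) lt_max ltrD2l ltrN2 c12.
Qed.

(** [lam] is the Lagrange multiplier of the sum constraint, the second clause being complementary
    slackness. It is 0 if level 0 meets the budget, otherwise a level spending exactly [b]. The
    threshold clause turns events about [lam] into events about [clip_sum]. *)
Lemma water_level_exists x (b : R) : 0 < b ->
  exists lam, [/\ 0 <= lam, lam * (clip_sum x lam - b) = 0 &
    forall c, 0 <= c -> (lam <= c) = (clip_sum x c <= b)].
Proof.
move=> b0; have [le0b|ltb0] := leP (clip_sum x 0) b.
  exists 0; rewrite mul0r; split=> // c c0; rewrite c0.
  apply/esym; move: c0; rewrite le_eqVlt => /predU1P[<-//|c0].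
  rewrite leNgt; apply/negP => bc.
  by have := clip_sum_lt c0 (lt_trans b0 bc); rewrite ltNge (le_trans le0b (ltW bc)).
(* [M] dominates every coordinate, so the clipped sum goes from above [b] at 0 to zero at [M]. *)
pose M := \sum_(i < n) `|x ord0 i|.
have M0 : 0 <= M by apply: sumr_ge0.
have clipM : clip_sum x M = 0.
  apply: big1 => i _; apply/max_idPr; rewrite subr_le0 (le_trans (ler_norm _))//.
  by rewrite /M (bigD1 i)//= lerDl sumr_ge0.
have [||lam + lamb] := @IVT R (clip_sum x) 0 M b M0.
  exact/continuous_subspaceT/clip_sum_continuous.
  by rewrite clipM ge_min (ltW b0) orbT le_max (ltW ltb0).
rewrite in_itv/= => /andP[lam0 _]; exists lam; rewrite lamb subrr mulr0.
split=> // c c0; apply/idP/idP.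
  (* A value above [b] at some [c] beyond [lam] would be positive, hence smaller than the value [b]
     at [lam]. *)
  rewrite le_eqVlt => /predU1P[<-|lamc]; first by rewrite lamb.
  rewrite leNgt; apply/negP => bc.
  by have := clip_sum_lt lamc (lt_trans b0 bc); rewrite lamb ltNge (ltW bc).
move=> cb; rewrite leNgt; apply/negP => clam.
by have := clip_sum_lt (x := x) clam; rewrite lamb => /(_ b0); rewrite ltNge cb.
Qed.

(** The KKT conditions suffice: slackness replaces [lam * pmax] by [lam] times the sum of [y], and
    the variational inequality is then checked coordinatewise. *)
Lemma Proj_power_region (pmax lam : R) x : 0 <= lam ->
  lam * (clip_sum x lam - pmax) = 0 -> clip_sum x lam <= pmax ->
  let y := \row_i Num.max (x ord0 i - lam) 0 in
  [/\ Proj (power_region pmax) x = y, power_region pmax y &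
    forall z, power_region pmax z -> dotv (x - y) (z - y) <= 0].
Proof.
move=> lam0 slack feas y.
have yE i : y ord0 i = Num.max (x ord0 i - lam) 0 by rewrite mxE.
have sumy : \sum_(i < n) y ord0 i = clip_sum x lam.
  by apply: eq_bigr => i _; rewrite yE.
have Py : power_region pmax y.
  by split=> [|i]; rewrite ?sumy// yE le_max lexx orbT.
have var z : power_region pmax z -> dotv (x - y) (z - y) <= 0.
  move=> [zsum z0].
  apply: (@le_trans _ _ (lam * (\sum_(i < n) z ord0 i - pmax))); last first.
    by rewrite mulr_ge0_le0// subr_le0.
  have -> : lam * (\sum_(i < n) z ord0 i - pmax) =
            lam * (\sum_(i < n) z ord0 i - \sum_(i < n) y ord0 i).
    by move: slack => /eqP; rewrite sumy !mulrBr subr_eq0 => /eqP ->.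
  rewrite -sumrB mulr_sumr; apply: ler_sum => i _.
  (* Either y_i = x_i - lam and both sides agree, or y_i = 0 with x_i <= lam and z_i >= 0. *)
  by rewrite !mxE; case: (leP (x ord0 i - lam) 0) => xi; have zi := z0 i; nra.
by split=> //; exact: Proj_variational.
Qed.

End Projection.

Lemma power_region0 (R : realType) (n : nat) (pmax : R) : 0 <= pmax ->
  power_region pmax (0 : 'rV[R]_n).
Proof.
by move=> pmax0; split=> [|i]; rewrite ?big1 ?mxE// => i _; rewrite mxE.
Qed.

Lemma Proj_power_regionP (R : realType) (n : nat) (pmax : R) (x : 'rV[R]_n) :
  0 < pmax -> let y := Proj (power_region pmax) x in
  power_region pmax y /\
  forall z, power_region pmax z -> dotv (x - y) (z - y) <= 0.
Proof.
move=> pmax0 y; have [lam [lam0 slack feas]] := water_level_exists x pmax0.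
have := @Proj_power_region _ _ pmax lam x lam0 slack.
by rewrite -(feas _ lam0) lexx -/y => /(_ isT)[<-].
Qed.

(** * Measurability of the trajectory *)

Section Measurability.
Context {R : realType} {d : measure_display} {T : measurableType d}.

(** Only the water level is implicit. For c >= 0 the event lam > c says that the clipped sum at c
    exceeds [pmax], which is measurable; for c < 0 it is the whole space. *)
Lemma measurable_Proj_power_region (n : nat) (pmax : R) (X : T -> 'rV[R]_n) :
  0 < pmax -> (forall i, measurable_fun setT (fun t => X t ord0 i)) ->
  forall i, measurable_fun setT (fun t => Proj (power_region pmax) (X t) ord0 i).
Proof.
move=> pmax0 mX i.
have [lam lamP] := choice (fun t => water_level_exists (X t) pmax0).
have mclip c : measurable_fun setT (fun t => clip_sum (X t) c).
  apply: measurable_sum => j; apply: measurable_maxr => //.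
  by apply: measurable_funB.
have mlam : measurable_fun setT lam.
  apply: (measurability (@RGenOInfty.G R)) => [|/= _ [_] [c] -> <-].
    exact: RGenOInfty.measurableE.
  rewrite setTI; have [c0|c0] := leP 0 c.
    rewrite (_ : _ @^-1` _ = (fun t => clip_sum (X t) c) @^-1` `]pmax, +oo[).
      by rewrite -[X in measurable X]setTI; exact: mclip.
    apply/seteqP; split=> t/=; have [_ _ /(_ _ c0)] := lamP t;
      by rewrite !in_itv/= !andbT !ltNge => ->.
  rewrite (_ : _ @^-1` _ = setT)//; apply/seteqP; split=> t//= _.
  by have [lam0 _ _] := lamP t; rewrite in_itv/= andbT (lt_le_trans c0).
rewrite (_ : (fun t => _) = fun t => Num.max (X t ord0 i - lam t) 0).
  apply: measurable_maxr => //; exact: measurable_funB.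
apply/funext => t; have [lam0 slack feas] := lamP t.
have := @Proj_power_region _ _ pmax _ _ lam0 slack.
by rewrite -(feas _ lam0) lexx => /(_ isT)[-> _ _]; rewrite mxE.
Qed.

(** Trace measurability suffices because (X, W) never leaves the domain: a preimage under [f] is the
    trace of a measurable [C], whose pullback is the event sought. *)
Lemma jointly_measurable_comp (n : nat) (pmax : R) (dS : measure_display)
    (S : measurableType dS) (Omega : set (R * S)) (f : 'rV[R]_n -> R * S -> R)
    (X : T -> 'rV[R]_n) (W : T -> R * S) :
  jointly_measurable pmax Omega f ->
  (forall i, measurable_fun setT (fun t => X t ord0 i)) ->
  measurable_fun setT W ->
  (forall t, power_region pmax (X t)) -> (forall t, Omega (W t)) ->
  measurable_fun setT (fun t => f (X t) (W t)).
Proof.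
move=> mf mX mW PX OW _ A mA; rewrite setTI.
have [C mC CE] := mf _ (ex_intro2 _ _ A mA erefl).
pose Z t := ([tuple X t ord0 i | i < n], W t).
have mZ : measurable_fun setT Z.
  apply: measurable_fun_pair => //; apply/measurable_fun_tnthP => i.
  rewrite (_ : _ \o _ = fun t => X t ord0 i)//.
  by apply/funext => t/=; rewrite tnth_mktuple.
have rowZ t : \row_i tnth (Z t).1 i = X t.
  by apply/rowP => i; rewrite mxE tnth_mktuple.
rewrite (_ : _ @^-1` A = Z @^-1` C).
  by rewrite -[X in measurable X]setTI; exact: mZ.
have CA t : C (Z t) <-> A (f (X t) (W t)).
  have /seteqP[/(_ (Z t))/= CE1 /(_ (Z t))/= CE2] := CE.
  rewrite rowZ in CE1 CE2; split=> [Ct|At].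
    by have [] := CE1 (conj Ct (conj (PX t) (OW t))).
  by have [] := CE2 (conj (conj (PX t) (OW t)) At).
by apply/seteqP; split=> t /CA.
Qed.

Section Trajectory.
Context {dS : measure_display} {S : measurableType dS}.
Variables (n : nat) (pmax V : R) (Omega : set (R * S)).
Variables (gradU : 'rV[R]_n -> R * S -> 'rV[R]_n) (omega : nat -> T -> R * S).
Variables (Q : nat -> T -> R) (p : nat -> T -> 'rV[R]_n).
Hypothesis pmax0 : 0 < pmax.
Hypothesis alg : algorithm1 pmax V gradU omega Q p.
Hypothesis omega_in : forall t x, (1 <= t)%N -> Omega (omega t x).

Lemma power_in_region t x : (1 <= t)%N -> power_region pmax (p t x).
Proof.
case: t => [//|[|t] _].
  by rewrite (power_init alg); exact: power_region0 (ltW pmax0).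
by rewrite (power_step alg)//; exact: (Proj_power_regionP _ pmax0).1.
Qed.

Hypothesis mgrad :
  forall i, jointly_measurable pmax Omega (fun p w => gradU p w ord0 i).

(** [Q t] and [p t.+1] are functions of the first [t] states. The sigma-algebra on [T] is arbitrary
    and only states up to [N] are assumed measurable, so that both the ambient sigma-algebra and the
    history can be used. *)
Lemma measurable_trajectory (N : nat) :
  (forall t, (1 <= t <= N)%N -> measurable_fun setT (omega t)) ->
  forall t, (t <= N)%N -> measurable_fun setT (Q t) /\
    forall i, measurable_fun setT (fun x => p t.+1 x ord0 i).
Proof.
move=> momega; elim=> [_|t IH tN].
  split=> [|i].
    by rewrite (_ : Q 0%N = cst 0)//; apply/funext => x; rewrite (queue_init alg).
  rewrite (_ : (fun x => _) = cst 0)//.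
  by apply/funext => x; rewrite (power_init alg) mxE.
have [mQ mp] := IH (ltnW tN).
have mw : measurable_fun setT (omega t.+1) by apply: momega.
have mQ1 : measurable_fun setT (Q t.+1).
  rewrite (_ : Q t.+1 = fun x => Num.min
      (Q t x + energy omega t.+1 x - \sum_(i < n) p t.+1 x ord0 i) 0).
    apply: measurable_minr => //; apply: measurable_funB; last exact: measurable_sum.
    by apply: measurable_funD => //; exact: measurableT_comp measurable_fst mw.
  by apply/funext => x; rewrite (queue_step alg).
split=> // i.
rewrite (_ : (fun x => _) = fun x => Proj (power_region pmax)
  (p t.+1 x + V^-1 *: gradU (p t.+1 x) (omega t.+1 x)
       + (V ^- 2 * Q t.+1 x) *: const_mx 1) ord0 i); last first.
  by apply/funext => x; rewrite (power_step alg).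
apply: measurable_Proj_power_region => // j.
rewrite (_ : (fun x => _) = fun x => p t.+1 x ord0 j +
   V^-1 * gradU (p t.+1 x) (omega t.+1 x) ord0 j + V ^- 2 * Q t.+1 x); last first.
  by apply/funext => x; rewrite !mxE mulr1.
apply: measurable_funD; last exact: measurable_funM.
apply: measurable_funD => //; apply: measurable_funM => //.
apply: (jointly_measurable_comp (f := fun p w => gradU p w ord0 j)) => // x.
  exact: power_in_region.
exact: omega_in.
Qed.

End Trajectory.
End Measurability.

(** * Expectation of a product of independent variables *)

(** The joint law agrees with the product of the marginals on rectangles, hence everywhere; Tonelli
    then factors the integral. *)
Lemma ge0_integralM_independent (R : realType) (d : measure_display)
    (T : measurableType d) (P : probability T R) (X Y : {RV P >-> R}) :
  (forall x, 0 <= X x) -> (forall x, 0 <= Y x) ->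
  (forall A B, measurable A -> measurable B ->
    P (X @^-1` A `&` Y @^-1` B) = (P (X @^-1` A) * P (Y @^-1` B))%E) ->
  (\int[P]_x (X x * Y x)%:E = \int[P]_x (X x)%:E * \int[P]_x (Y x)%:E)%E.
Proof.
move=> X0 Y0 XY.
pose mX := distribution P X; pose mY := distribution P Y.
have mXY : measurable_fun setT (fun x => (X x, Y x)) by exact: measurable_fun_pair.
pose Z : {RV P >-> (R * R)%type} :=
  HB.pack (fun x => (X x, Y x)) (isMeasurableFun.Build _ _ _ _ _ mXY).
have joint : forall C, measurable C -> (mX \x mY)%E C = distribution P Z C.
  by apply: product_measure_unique => A B mA mB; rewrite -XY.
(* Absolute values make the integrand nonnegative on the whole plane and change nothing on the range
   of (X, Y). *)
pose f (z : R * R) : \bar R := (`|z.1| * `|z.2|)%:E.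
have mf : measurable_fun [set: (R * R)%type] f.
  apply/measurable_EFinP; apply: measurable_funM; apply: measurableT_comp => //.
have f0 z : (0 <= f z)%E by rewrite lee_fin mulr_ge0.
have mabs : measurable_fun setT (fun x : R => `|x|%:E).
  by apply/measurable_EFinP; exact: normr_measurable.
transitivity (\int[P]_x (f \o Z) x)%E.
  by apply: eq_integral => x _; rewrite /f/= !ger0_norm.
rewrite -ge0_integral_distribution//.
rewrite -(@eq_measure_integral _ _ _ _ _ (mX \x mY)%E)//; last first.
  by move=> C mC _; exact: joint.
rewrite fubini_tonelli1//=.
transitivity (\int[mX]_x (`|x|%:E * \int[mY]_y `|y|%:E))%E.
  apply: eq_integral => x _.
  by rewrite -ge0_integralZl//; apply: eq_integral => y _; rewrite /f EFinM.
rewrite (eq_integral (fun x : R => (\int[mY]_y `|y|%:E * `|x|%:E)%E)); last first.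
  by move=> x _; rewrite muleC.
rewrite ge0_integralZl//; last by apply: integral_ge0.
rewrite muleC !ge0_integral_distribution//.
by congr (_ * _)%E; apply: eq_integral => x _ /=; rewrite ger0_norm.
Qed.

(** * Deterministic inequalities for one slot *)

(** Multiply the optimality inequality by V^2 and complete the square: the remainder is |g - V (y -
    p)|^2 / 2 >= 0. *)
Lemma projected_step (R : realType) (n : nat) (V Q : R) (p q g y : 'rV[R]_n) :
  0 < V -> dotv (p + V^-1 *: g + (V ^- 2 * Q) *: const_mx 1 - y) (q - y) <= 0 ->
  V * dotv g (q - p) <= dotv g g / 2
    + Q * (\sum_(i < n) y ord0 i - \sum_(i < n) q ord0 i)
    + V ^+ 2 / 2 * (dotv (q - p) (q - p) - dotv (q - y) (q - y)).
Proof.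
move=> V0 /(mulr_ge0_le0 (sqr_ge0 V)) opt; rewrite -subr_ge0.
apply: le_trans (_ : - (V ^+ 2 *
    dotv (p + V^-1 *: g + (V ^- 2 * Q) *: const_mx 1 - y) (q - y)) <= _).
  by rewrite oppr_ge0.
rewrite /dotv -!sumrB !mulr_sumr mulr_suml -!big_split/= -sumrN -sumrB.
apply: ler_sum => i _; rewrite !mxE mulr1.
set a := p _ _; set b := g _ _; set c := y _ _; set e := q _ _.
rewrite -subr_ge0.
rewrite [leRHS](_ : _ = (b - V * (c - a)) ^+ 2 / 2).
  by rewrite divr_ge0 ?sqr_ge0.
by field; rewrite gt_eqF.
Qed.

(** Truncation at 0 cannot increase the square. Expanding leaves (e - s)^2, and two numbers between
    0 and the maximum differ by at most that maximum. *)
Lemma queue_drift (R : realType) (emax pmax Q e s : R) :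
  Q <= 0 -> 0 <= e <= emax -> 0 <= s <= pmax ->
  Num.min (Q + e - s) 0 ^+ 2 <=
  Q ^+ 2 + 2 * (Q * (e - s)) + Num.max emax pmax ^+ 2.
Proof.
move=> Q0 /andP[e0 eM] /andP[s0 sM].
have eB : e <= Num.max emax pmax by rewrite le_max eM.
have sB : s <= Num.max emax pmax by rewrite le_max sM orbT.
set B := Num.max _ _ in eB sB *.
have B0 := le_trans e0 eB.
apply: (@le_trans _ _ ((Q + e - s) ^+ 2)).
  by case: (leP (Q + e - s) 0) => // _; rewrite expr0n sqr_ge0.
have : (e - s) ^+ 2 <= B ^+ 2.
  rewrite -real_normK ?num_real// ler_sqr ?nnegrE// ler_norml.
  by apply/andP; split; lra.
nra.
Qed.

(** Each q_i is at most [pmax], so q_i^2 <= pmax q_i. This will bound the initial distance |q -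
    p[1]|^2, as p[1] = 0. *)
Lemma power_region_sqr (R : realType) (n : nat) (pmax : R) (q : 'rV[R]_n) :
  power_region pmax q -> dotv q q <= pmax ^+ 2.
Proof.
move=> [qs q0]; have qM i : q ord0 i <= pmax.
  by apply: le_trans qs; rewrite (bigD1 i)//= lerDl sumr_ge0.
have pmax0 : 0 <= pmax by apply: le_trans qs; apply: sumr_ge0.
apply: (@le_trans _ _ (\sum_(i < n) pmax * q ord0 i)).
  by apply: ler_sum => i _; apply: ler_wpM2r.
by rewrite -mulr_sumr expr2 ler_wpM2l.
Qed.

Lemma bounded_integrable (R : realType) (d : measure_display)
    (T : measurableType d) (P : probability T R) (f : T -> R) (M : R) :
  measurable_fun setT f -> (forall x, `|f x| <= M) ->
  P.-integrable setT (EFin \o f).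
Proof.
move=> mf fM; apply: measurable_bounded_integrable => //.
  by rewrite (le_lt_trans (probability_le1 _ _))// ltry.
by exists M; split; rewrite ?num_real// => N MN x _; apply: le_trans (fM x) (ltW MN).
Qed.

(** * Drift-plus-penalty bounds along a sample path *)

Section Model.
Context {R : realType} {dS : measure_display} {S : measurableType dS}.
Variables (n : nat) (pmax D : R) (Omega : set (R * S)) (Di : 'I_n -> R).
Variables (U : 'rV[R]_n -> R * S -> R) (gradU : 'rV[R]_n -> R * S -> 'rV[R]_n).
Hypothesis model : utility_model pmax Omega D Di U gradU.

(** Two points of the region differ by at most [pmax] in each coordinate. Used with [p] and [q] in
    both orders, it bounds the utility gap uniformly in the state. *)
Lemma utility_lipschitz p q w :
  Omega w -> power_region pmax p -> power_region pmax q ->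
  U q w - U p w <= (\sum_(i < n) Di i) * pmax.
Proof.
move=> Ow Pp Pq; rewrite lerBlDl.
apply: le_trans (utility_subgradient model Ow Pp Pq) _; rewrite lerD2l.
rewrite mulr_suml; apply: ler_sum => i _; apply: le_trans (ler_norm _) _.
rewrite normrM; apply: ler_pM => //.
  exact: utility_component_bound model _ _ _ Ow Pp.
have bnd (v : 'rV_n) : power_region pmax v -> 0 <= v ord0 i <= pmax.
  move=> [vs v0]; rewrite v0; apply: le_trans vs.
  by rewrite (bigD1 i)//= lerDl sumr_ge0.
move: (bnd _ Pp) (bnd _ Pq); rewrite !mxE ler_norml => /andP[? ?] /andP[? ?].
by apply/andP; split; lra.
Qed.

Context {d : measure_display} {T : measurableType d}.
Variables (P : probability T R) (V emax ebar : R) (omega : nat -> T -> R * S).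
Variables (Q : nat -> T -> R) (p : nat -> T -> 'rV[R]_n).
Hypothesis pmax0 : 0 < pmax.
Hypothesis V0 : 0 < V.
Hypothesis state : noniid_state_model P Omega emax ebar omega.
Hypothesis alg : algorithm1 pmax V gradU omega Q p.

Let B := Num.max emax pmax ^+ 2.

(** One slot lowers Q by at most [pmax], since e >= 0. The lower bound makes Q integrable for each
    fixed [t]. *)
Lemma queue_bound t x : - (pmax *+ t) <= Q t x <= 0.
Proof.
elim: t => [|t /andP[lb ub]]; first by rewrite (queue_init alg) mulr0n oppr0 lexx.
rewrite (queue_step alg)//= ge_min lexx orbT andbT le_min.
have [ps _] := power_in_region pmax0 alg x (isT : (1 <= t.+1)%N).
have /andP[e0 _] := energy_range state x (isT : (1 <= t.+1)%N).
rewrite oppr_le0 mulrn_wge0 ?(ltW pmax0)// andbT mulrS; lra.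
Qed.

Lemma queue1 x : Q 1%N x = 0.
Proof.
rewrite (queue_step alg)// (queue_init alg) add0r; apply/min_idPr.
rewrite big1 => [|i _]; last by rewrite (power_init alg) mxE.
by rewrite subr0; have /andP[] := energy_range state x (isT : (1 <= 1)%N).
Qed.

(** The step bound contains Q[t] (sum y - sum q) and half the drift bound contains Q[t] (e[t+1] -
    sum y). Adding them eliminates the sum of y = p[t+1]. *)
Lemma drift_plus_penalty (q : 'rV[R]_n) t x : (1 <= t)%N -> power_region pmax q ->
  V * (U q (omega t x) - U (p t x) (omega t x)) <=
    (D ^+ 2 + B) / 2 + Q t x * (energy omega t.+1 x - \sum_(i < n) q ord0 i)
    + V ^+ 2 / 2 *
      (dotv (q - p t x) (q - p t x) - dotv (q - p t.+1 x) (q - p t.+1 x))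
    + (Q t x ^+ 2 - Q t.+1 x ^+ 2) / 2.
Proof.
move=> t1 Pq; set y := p t.+1 x; set g := gradU (p t x) (omega t x).
have Ow := state_in state x t1.
have Pp := power_in_region pmax0 alg x t1.
have := (Proj_power_regionP
  (p t x + V^-1 *: g + (V ^- 2 * Q t x) *: const_mx 1) pmax0).2 q Pq.
rewrite -(power_step alg)// -/y => /(projected_step V0) step.
have gD : dotv g g <= D ^+ 2.
  rewrite -norm2_sqr ler_sqr ?nnegrE ?sqrtr_ge0//.
    exact: (utility_gradient_bound model).
  by apply: le_trans (utility_gradient_bound model Ow Pp); exact: sqrtr_ge0.
have /(ler_wpM2l (ltW V0)) sub :
    U q (omega t x) - U (p t x) (omega t x) <= dotv g (q - p t x).
  by rewrite lerBlDl; exact: (utility_subgradient model).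
have /andP[_ Q0] := queue_bound t x.
have [ys y0] := power_in_region pmax0 alg x (isT : (1 <= t.+1)%N).
have := @queue_drift _ emax pmax _ _ (\sum_(i < n) y ord0 i) Q0
  (energy_range state x (isT : (1 <= t.+1)%N)).
rewrite ys sumr_ge0// => /(_ isT).
rewrite -(queue_step alg (t := t.+1))// -/B => drift.
lra.
Qed.

Lemma drift_plus_penalty_sum (q : 'rV[R]_n) t x : power_region pmax q ->
  \sum_(1 <= k < t.+1) V * (U q (omega k x) - U (p k x) (omega k x)) <=
    t%:R * ((D ^+ 2 + B) / 2) + V ^+ 2 / 2 * pmax ^+ 2 +
    \sum_(1 <= k < t.+1) Q k x * (energy omega k.+1 x - \sum_(i < n) q ord0 i).
Proof.
move=> Pq.
(* A quadratic potential in distance and queue. Keeping its final value on the left makes the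
   induction telescope; being nonnegative, it can then be dropped. *)
pose slack k := V ^+ 2 / 2 * dotv (q - p k x) (q - p k x) + Q k x ^+ 2 / 2.
have slack0 k : 0 <= slack k.
  by rewrite addr_ge0 ?divr_ge0 ?sqr_ge0// mulr_ge0 ?dotv_ge0// divr_ge0 ?sqr_ge0.
suff : \sum_(1 <= k < t.+1) V * (U q (omega k x) - U (p k x) (omega k x))
    + slack t.+1 <=
    t%:R * ((D ^+ 2 + B) / 2) + V ^+ 2 / 2 * pmax ^+ 2 +
    \sum_(1 <= k < t.+1) Q k x * (energy omega k.+1 x - \sum_(i < n) q ord0 i).
  by apply: le_trans; rewrite lerDl.
elim: t => [|t IH].
  (* At slot 1 both Q and p vanish, so the potential is V^2 |q|^2 / 2. *)
  rewrite !big_nil !add0r mul0r add0r addr0 /slack queue1 expr0n mul0r addr0.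
  rewrite (power_init alg) subr0 ler_wpM2l ?divr_ge0 ?sqr_ge0//.
  exact: power_region_sqr.
rewrite !(big_nat_recr t.+1)//= -(natr1 t).
have := @drift_plus_penalty q t.+1 x isT Pq.
move: IH; rewrite /slack; lra.
Qed.

End Model.

(** * Measurability with respect to the history, and expectations *)

Lemma history_measurable (R : realType) (dS d : measure_display)
    (S : measurableType dS) (T : measurableType d) (omega : nat -> T -> R * S)
    (N k : nat) : (1 <= k <= N)%N ->
  measurable_fun [set: g_sigma_algebraType
    (\bigcup_(tau in [set k : nat | (1 <= k <= N)%N])
       g_sigma_algebra_preimage (omega tau))] (omega k).
Proof.
move=> kN _ A mA; apply: sub_sigma_algebra; exists k => //.
by exists A.
Qed.

Lemma Rintegral_sum (R : realType) (d : measure_display) (T : measurableType d)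
    (mu : {measure set T -> \bar R}) (f : nat -> T -> R) (t : nat) :
  (forall k, (1 <= k)%N -> mu.-integrable setT (EFin \o f k)) ->
  mu.-integrable setT (EFin \o fun x => \sum_(1 <= k < t.+1) f k x) /\
  \int[mu]_x (\sum_(1 <= k < t.+1) f k x) =
  \sum_(1 <= k < t.+1) \int[mu]_x f k x.
Proof.
move=> fi; elim: t => [|t [IHi IH]].
  rewrite big_nil; under eq_Rintegral do rewrite big_nil.
  rewrite Rintegral_cst// mul0r; split=> //.
  rewrite (_ : _ \o _ = EFin \o cst 0); first exact: integrable0.
  by apply/funext => x /=; rewrite big_nil.
have ft := fi t.+1 isT.
rewrite big_nat_recr//= -IH -RintegralD//; split; last first.
  by apply: eq_Rintegral => x _; rewrite big_nat_recr.
have := integrableD measurableT IHi ft; apply: eq_integrable => // x _ /=.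
by rewrite [in RHS](big_nat_recr t.+1).
Qed.

Section Expectation.
Context {R : realType} {dS : measure_display} {S : measurableType dS}.
Variables (n : nat) (pmax D : R) (Omega : set (R * S)) (Di : 'I_n -> R).
Variables (U : 'rV[R]_n -> R * S -> R) (gradU : 'rV[R]_n -> R * S -> 'rV[R]_n).
Hypothesis model : utility_model pmax Omega D Di U gradU.
Context {d : measure_display} {T : measurableType d}.
Variables (P : probability T R) (V emax ebar : R) (omega : nat -> T -> R * S).
Variables (Q : nat -> T -> R) (p : nat -> T -> 'rV[R]_n).
Hypothesis pmax0 : 0 < pmax.
Hypothesis V0 : 0 < V.
Hypothesis state : noniid_state_model P Omega emax ebar omega.
Hypothesis alg : algorithm1 pmax V gradU omega Q p.

Lemma measurable_queue t : measurable_fun setT (Q t).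
Proof.
apply: (measurable_trajectory pmax0 alg (state_in state)
  (utility_gradient_measurable model) (N := t) _ (leqnn t)).1.
by move=> k /andP[k1 _]; exact: (state_measurable state).
Qed.

Lemma measurable_power t i : measurable_fun setT (fun x => p t.+1 x ord0 i).
Proof.
apply: (measurable_trajectory pmax0 alg (state_in state)
  (utility_gradient_measurable model) (N := t) _ (leqnn t)).2.
by move=> k /andP[k1 _]; exact: (state_measurable state).
Qed.

(** Trajectory measurability is replayed on [T] with the history as sigma-algebra, for which the
    states up to [t] are measurable by construction. *)
Lemma queue_history t A : measurable A -> history omega t (Q t @^-1` A).
Proof.
move=> mA; pose G := \bigcup_(tau in [set k : nat | (1 <= k <= t)%N])
        g_sigma_algebra_preimage (omega tau).
(* The recursion is pointwise, so it holds verbatim over the new sigma-algebra. *)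
have algG : @algorithm1 _ _ _ S (g_sigma_algebraType G) n pmax V gradU omega Q p.
  by case: alg => *; split.
have [mQ _] := measurable_trajectory pmax0 algG (state_in state)
  (utility_gradient_measurable model)
  (@history_measurable R dS d S T omega t) (leqnn t).
by have := mQ measurableT _ mA; rewrite setTI.
Qed.

Lemma measurable_energy t : (1 <= t)%N -> measurable_fun setT (energy omega t).
Proof.
by move=> t1; apply: (measurableT_comp measurable_fst); exact: (state_measurable state).
Qed.

Lemma queue_integrable t : P.-integrable setT (EFin \o Q t).
Proof.
apply: (bounded_integrable P (M := pmax *+ t)) => [|x]; first exact: measurable_queue.
have /andP[lb ub] := queue_bound pmax0 state alg t x.
by rewrite ler0_norm// lerNl.
Qed.

Lemma energy_queue_integrable t : 
  P.-integrable setT (EFin \o (fun x => energy omega t.+1 x * - Q t x)).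
Proof.
apply: (bounded_integrable P (M := emax * (pmax *+ t))) => [|x].
  apply: measurable_funM; first exact: measurable_energy.
  by apply: measurableT_comp => //; exact: measurable_queue.
have /andP[e0 eM] := energy_range state x (isT : (1 <= t.+1)%N).
have /andP[lb ub] := queue_bound pmax0 state alg t x.
by rewrite ger0_norm ?mulr_ge0 ?oppr_ge0// ler_pM ?oppr_ge0// lerNl.
Qed.

(** The product formula asks for nonnegative factors, so it is applied to e[t+1] and -Q[t], and the
    signs are restored afterwards. *)
Lemma queue_energy_mean t : (1 <= t)%N ->
  (\int[P]_x (Q t x * energy omega t.+1 x) = ebar * \int[P]_x Q t x)%R.
Proof.
move=> t1; have mQ := measurable_queue t.
have me := measurable_energy (isT : (1 <= t.+1)%N).
have mNQ : measurable_fun setT (fun x => - Q t x) by exact: measurableT_comp.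
pose X : {RV P >-> R} :=
  HB.pack (energy omega t.+1) (isMeasurableFun.Build _ _ _ _ _ me).
pose Y : {RV P >-> R} :=
  HB.pack (fun x => - Q t x) (isMeasurableFun.Build _ _ _ _ _ mNQ).
have : (\int[P]_x (X x * Y x)%:E = \int[P]_x (X x)%:E * \int[P]_x (Y x)%:E)%E.
  apply: ge0_integralM_independent => [x|x|A B mA mB].
  - by have /andP[] := energy_range state x (isT : (1 <= t.+1)%N).
  - by rewrite /= oppr_ge0; have /andP[] := queue_bound pmax0 state alg t x.
  apply: (energy_indep_history state t1 mA).
  (* -Q[t] lies in [B] exactly when Q[t] lies in the reflected set, an event of the history. *)
  rewrite (_ : _ @^-1` B = Q t @^-1` (-%R @^-1` B))//; apply: queue_history.
  by rewrite -[X in measurable X]setTI; exact: oppr_measurable.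
have := energy_mean state (isT : (1 <= t.+1)%N); rewrite unlock /= => ->.
move=> prod.
have iNQ : P.-integrable setT (EFin \o (fun x => - Q t x)).
  exact: (integrableN (queue_integrable t)).
have prodN : \int[P]_x (energy omega t.+1 x * - Q t x) = ebar * \int[P]_x (- Q t x).
  rewrite /Rintegral prod fineM//; exact: (integrable_fin_num measurableT iNQ).
transitivity (\int[P]_x (-1 * (energy omega t.+1 x * - Q t x))).
  by apply: eq_Rintegral => x _; ring.
rewrite RintegralZl//; last exact: energy_queue_integrable.
rewrite prodN mulN1r -mulrN; congr (_ * _); rewrite -mulN1r -RintegralZl//.
by apply: eq_Rintegral => x _; ring.
Qed.

(** The expectation equals (ebar - s) E[Q[t]], a nonnegative number times a nonpositive one. *)
Lemma queue_surplus_mean (s : R) t : (1 <= t)%N -> s <= ebar ->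
  \int[P]_x (Q t x * (energy omega t.+1 x - s)) <= 0.
Proof.
move=> t1 sle.
have iQe : P.-integrable setT (EFin \o (fun x => Q t x * energy omega t.+1 x)).
  have := energy_queue_integrable t; move/(integrableN).
  apply: eq_integrable => // x _ /=; congr EFin; ring.
have iQ := queue_integrable t.
have -> : \int[P]_x (Q t x * (energy omega t.+1 x - s)) =
          \int[P]_x (Q t x * energy omega t.+1 x - s * Q t x).
  by apply: eq_Rintegral => x _; ring.
rewrite RintegralB//; last exact: (integrableZl measurableT s iQ).
rewrite queue_energy_mean// RintegralZl// -mulrBl mulr_ge0_le0 ?subr_ge0//.
have := @le_Rintegral _ _ _ P _ (Q t) (cst 0) measurableT iQ.
rewrite Rintegral_cst// mul0r; apply => [|x _].
  exact: finite_measure_integrable_cst.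
by have /andP[] := queue_bound pmax0 state alg t x.
Qed.

(** U(p[t]; w[t]) differs from the integrable U(0; w[t]) by a bounded measurable amount. *)
Lemma utility_integrable t : (1 <= t)%N ->
  P.-integrable setT (fun x => (U 0 (omega t x))%:E) ->
  P.-integrable setT (EFin \o fun x => U (p t x) (omega t x)).
Proof.
move=> t1 iU0.
have PX x : power_region pmax (p t x) by apply: (power_in_region pmax0 alg).
have P0 : power_region pmax (0 : 'rV[R]_n) by exact: power_region0 (ltW pmax0).
have mUp : measurable_fun setT (fun x => U (p t x) (omega t x)).
  apply: (jointly_measurable_comp (utility_measurable model)) => //.
  (* Measurability of the power is available in the form [p t.+1], hence the case split; slot 0 is
     excluded. *)
  - by move=> i; case: t t1 {iU0 PX} => // t _; exact: measurable_power.
  - exact: (state_measurable state).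
  - by move=> x; exact: (state_in state).
have mU0 : measurable_fun setT (fun x => U 0 (omega t x)).
  exact/measurable_EFinP/(measurable_int P).
have : P.-integrable setT (EFin \o fun x => U (p t x) (omega t x) - U 0 (omega t x)).
  apply: (bounded_integrable P (M := (\sum_(i < n) Di i) * pmax)) => [|x].
    exact: measurable_funB.
  have Ow := state_in state x t1.
  by rewrite ler_norml lerNl opprB !(utility_lipschitz model).
move=> /(integrableD measurableT iU0); apply: eq_integrable => // x _ /=.
by rewrite -EFinD addrC subrK.
Qed.

(** Integrate the summed pathwise bound; the queue terms have nonpositive expectation and drop
    out. *)
Lemma mean_utility_sum (q : 'rV[R]_n) t :
  (forall r t, power_region pmax r -> (1 <= t)%N ->
    P.-integrable setT (fun x => (U r (omega t x))%:E)) ->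
  power_region pmax q -> \sum_(i < n) q ord0 i <= ebar ->
  V * \sum_(1 <= k < t.+1)
        (\int[P]_x U q (omega k x) - \int[P]_x U (p k x) (omega k x)) <=
    t%:R * ((D ^+ 2 + Num.max emax pmax ^+ 2) / 2) + V ^+ 2 / 2 * pmax ^+ 2.
Proof.
move=> iU Pq qs; set s := \sum_(i < n) q ord0 i in qs *.
have P0 : power_region pmax (0 : 'rV[R]_n) by exact: power_region0 (ltW pmax0).
pose f k x := V * (U q (omega k x) - U (p k x) (omega k x)).
pose g k x := Q k x * (energy omega k.+1 x - s).
have iUp k (k1 : (1 <= k)%N) := utility_integrable k1 (iU _ _ P0 k1).
have fi k : (1 <= k)%N -> P.-integrable setT (EFin \o f k).
  move=> k1; exact: (integrableZl measurableT V
    (integrableB measurableT (iU _ _ Pq k1) (iUp k k1))).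
have gi k : (1 <= k)%N -> P.-integrable setT (EFin \o g k).
  move=> k1; have iQe := integrableN (energy_queue_integrable k).
  have := integrableB measurableT iQe (integrableZl measurableT s (queue_integrable k)).
  by apply: eq_integrable => // x _ /=; rewrite -EFinB /g; congr EFin; ring.
have [isf sf] := Rintegral_sum t fi; have [isg sg] := Rintegral_sum t gi.
rewrite [leLHS](_ : _ = \int[P]_x \sum_(1 <= k < t.+1) f k x); last first.
  rewrite sf mulr_sumr; apply: eq_big_nat => k /andP[k1 _].
  rewrite RintegralZl//; last exact: (integrableB measurableT (iU _ _ Pq k1) (iUp k k1)).
  by rewrite RintegralB//; [exact: iU | exact: iUp].
set K := leRHS.
have iK : P.-integrable setT (EFin \o cst K) by exact: finite_measure_integrable_cst.
apply: (@le_trans _ _ (\int[P]_x (K + \sum_(1 <= k < t.+1) g k x))).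
  apply: le_Rintegral => //; first exact: (integrableD measurableT iK isg).
  by move=> x _; exact: (drift_plus_penalty_sum model pmax0 V0 state alg).
rewrite RintegralD// sg Rintegral_cst//= [X in fine X]probability_setT mulr1 gerDl.
rewrite big_seq sumr_le0// => k; rewrite mem_index_iota => /andP[k1 _].
exact: queue_surplus_mean.
Qed.

End Expectation.

(** * Time averages and the final bounds *)

Lemma avg_utilityE (R : realType) (dS d : measure_display)
    (S : measurableType dS) (T : measurableType d) (P : probability T R)
    (n : nat) (U : 'rV[R]_n -> R * S -> R) (omega : nat -> T -> R * S)
    (p : nat -> T -> 'rV[R]_n) (t : nat) :
  (forall k, (1 <= k)%N ->
    P.-integrable setT (EFin \o fun x => U (p k x) (omega k x))) ->
  avg_utility P U omega p t =
  (t%:R^-1 * \sum_(1 <= k < t.+1) \int[P]_x U (p k x) (omega k x))%:E.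
Proof.
move=> iU; rewrite /avg_utility EFinM -sumEFin; congr (_ * _)%E.
apply: eq_big_nat => k /andP[k1 _]; rewrite unlock /Rintegral fineK//.
exact: (integrable_fin_num measurableT (iU k k1)).
Qed.

Theorem theorem4 (R : realType) (pmax emax D : R)
    (pmax_gt0 : 0 < pmax) (emax_gt0 : 0 < emax) (D_gt0 : 0 < D) :
  let B := Num.max emax pmax ^+ 2 in
  exists C : R, 0 <= C /\
  forall (n : nat) (dS d : measure_display)
    (S : measurableType dS) (T : measurableType d) (P : probability T R)
    (Omega : set (R * S)) (Di : 'I_n -> R)
    (U : 'rV[R]_n -> R * S -> R) (gradU : 'rV[R]_n -> R * S -> 'rV[R]_n)
    (omega : nat -> T -> R * S) (ebar : R) (q : 'rV[R]_n) (V : R)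
    (Q : nat -> T -> R) (p : nat -> T -> 'rV[R]_n),
  (1 <= n)%N ->
  utility_model pmax Omega D Di U gradU ->
  noniid_state_model P Omega emax ebar omega ->
  (forall r t, power_region pmax r -> (1 <= t)%N ->
    P.-integrable setT (fun x => (U r (omega t x))%:E)) ->
  power_region pmax q -> \sum_(i < n) q ord0 i <= ebar ->
  0 < V ->
  algorithm1 pmax V gradU omega Q p ->
  (forall t : nat, (1 <= t)%N ->
    (avg_utility P U omega p t >=
     avg_utility P U omega (fun _ _ => q) t
     - (V * pmax ^+ 2 / (2 * t%:R))%:E
     - (B / (2 * V * t%:R))%:E
     - ((D ^+ 2 + B) / (2 * V))%:E)%E)
  /\
  (forall eps : R, 0 < eps -> V = 1 / eps ->
    forall t : nat, (1 <= t)%N -> 1 / eps ^+ 2 <= t%:R ->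
    (avg_utility P U omega p t >=
     avg_utility P U omega (fun _ _ => q) t - (C * eps)%:E)%E).
Proof.
move=> B; have B0 : 0 <= B by exact: sqr_ge0.
(* With V = 1/eps and t >= 1/eps^2 the errors are at most pmax^2 eps / 2 and (D^2 + B) eps / 2; the
   constant adds the two coefficients. *)
exists ((pmax ^+ 2 + (D ^+ 2 + B)) / 2); split.
  by rewrite divr_ge0// !addr_ge0// sqr_ge0.
move=> n dS d S T P Omega Di U gradU omega ebar q V Q p _ model state iU Pq qs.
move=> V0 alg.
have P0 : power_region pmax (0 : 'rV[R]_n) by exact: power_region0 (ltW pmax_gt0).
have iUp k (k1 : (1 <= k)%N) :=
  utility_integrable model pmax_gt0 state alg k1 (iU _ _ P0 k1).
(* Common core of both claims, in real numbers. The term B / (2 V t) is absent because Q[1] = 0;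
   subtracting it later only weakens the bound. *)
have bound t : (1 <= t)%N -> exists up uq : R,
    [/\ avg_utility P U omega p t = up%:E,
        avg_utility P U omega (fun _ _ => q) t = uq%:E &
        uq - V * pmax ^+ 2 / (2 * t%:R) - (D ^+ 2 + B) / (2 * V) <= up].
  move=> t1; have t0 : 0 < t%:R :> R by rewrite ltr0n.
  do 2!eexists; split.
  - by apply: avg_utilityE.
  - by apply: avg_utilityE => k; exact: iU.
  have := mean_utility_sum model pmax_gt0 V0 state alg t iU Pq qs.
  rewrite sumrB -/B; set uq := \sum_(_ <= _ < _) _; set up := \sum_(_ <= _ < _) _.
  (* Dividing by t V turns the summed bound into the averaged one. *)
  have tV0 : 0 < (t%:R * V)^-1 by rewrite invr_gt0 mulr_gt0.
  move=> /(ler_wpM2l (ltW tV0)); rewrite -subr_ge0 -[in X in _ -> X]subr_ge0.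
  by congr (0 <= _); field; rewrite !gt_eqF.
split=> [t t1|eps eps0 VE t t1 teps]; have [up [uq [-> -> le]]] := bound t t1;
  have t0 : 0 < t%:R :> R by rewrite ltr0n.
  rewrite -!EFinB lee_fin; apply: le_trans le.
  by rewrite lerD2r gerDl oppr_le0 divr_ge0// !mulr_ge0// ltW.
rewrite -EFinB lee_fin; apply: le_trans le.
have : (t%:R)^-1 <= eps ^+ 2.
  by rewrite -[leRHS]invrK lef_pV2 ?posrE ?invr_gt0 ?exprn_gt0// -div1r.
(* This factor turns 1/t into V pmax^2 / (2 t), since V = 1/eps. *)
rewrite -(ler_pM2l (_ : 0 < pmax ^+ 2 / (2 * eps))); last first.
  by rewrite divr_gt0 ?exprn_gt0// mulr_gt0.
have -> : V * pmax ^+ 2 / (2 * t%:R) = pmax ^+ 2 / (2 * eps) * t%:R^-1.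
  by rewrite VE; field; rewrite !gt_eqF.
have -> : (D ^+ 2 + B) / (2 * V) = (D ^+ 2 + B) / 2 * eps.
  by rewrite VE; field; rewrite !gt_eqF.
have -> : pmax ^+ 2 / (2 * eps) * eps ^+ 2 = pmax ^+ 2 / 2 * eps.
  by field; rewrite !gt_eqF.
lra.
Qed.
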